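(* Let $A\in\mathbb{R}^{m\times n}$, $d\ge n$, let $\{u_\ell\}_{\ell\in[L]}$ be a projective $2$-design for $\mathbb{R}^d$, let $\Pi:\mathbb{R}^d\to\mathbb{R}^n$ be the projection onto the first $n$ coordinates, and let $z$ be uniformly distributed over $\{\sqrt d\,\Pi u_\ell:\ell\in[L]\}$. Let $x\in\mathbb{R}^n$ be a unit vector and $y:=Azz^\top x$. Let $\gamma>0$ and $\eta\in(0,1)$, and choose positive integers $$J\ge\frac{4e^2\|A\|_{2\to\infty}^2}{\gamma^2},\qquad K\ge 2\log\Big(\frac m\eta\Big).$$ Let $\{y_{jk}\}_{j\in[J],k\in[K]}$ be independent copies of $y$, set $\overline y_k:=\frac1J\sum_{j\in[J]}y_{jk}$, and let $\hat\mu\in\mathbb{R}^m$ be the entrywise median of $\{\overline y_k\}_{k\in[K]}$, i.e. $\hat\mu_i=\operatorname{median}\{(\overline y_k)_i\}_{k\in[K]}$. Then $\|\hat\mu-Ax\|_\infty<\gamma$ with probability at least $1-\eta$.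
   Context: $\|A\|_{2\to\infty}$ denotes the largest Euclidean norm of a row of $A$; $\log$ is the natural logarithm. The median of $K$ reals is the middle order statistic (for even $K$, the average of the two middle order statistics). A projective $2$-design for $\mathbb{R}^d$ is a finite family $\{u_\ell\}_{\ell\in[L]}$ of unit vectors with $\frac1L\sum_\ell p(u_\ell)=\int_{S^{d-1}}p\,d\sigma$ for every homogeneous polynomial $p$ of degree $0$, $2$ or $4$ in $d$ real variables, where $\sigma$ is the uniform probability measure on $S^{d-1}$. *)

(* Defs.v *)
From HB Require Import structures.
From mathcomp Require Import all_boot all_order all_algebra.
From mathcomp Require Import all_classical all_reals all_analysis.
From mathcomp Require mpoly.
Set Implicit Arguments. Unset Strict Implicit. Unset Printing Implicit Defensive.
Import Order.TTheory GRing.Theory Num.Theory.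
Local Open Scope ring_scope.

Section Defs.
Variable R : realType.

Fixpoint iter_integral (d : nat) (F : seq R -> R) : R :=
  match d with
  | 0 => F [::]
  | d'.+1 => Rintegral (@lebesgue_measure R) setT
               (fun t : R => iter_integral d' (fun s => F (t :: s)))
  end.

Definition eucl_norm (d : nat) (v : 'I_d -> R) : R := Num.sqrt (\sum_i v i ^+ 2).

(* Integral of f against the uniform probability measure sigma on S^{d-1},
   defined through the (normalized) cone measure:
   int f dsigma = (1/vol(B)) * int_B f(x/|x|) dx, B the closed unit ball. *)
Definition sphere_integral (d : nat) (f : ('I_d -> R) -> R) : R :=
  let vec (s : seq R) : 'I_d -> R := fun i => nth 0 s i in
  let inB (s : seq R) : R := if eucl_norm (vec s) <= 1 then 1 else 0 in
  iter_integral d (fun s => inB s * f (fun i => vec s i / eucl_norm (vec s)))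
  / iter_integral d inB.

Definition projective_2design (d L : nat) (u : 'I_L -> 'cV[R]_d) : Prop :=
  (forall l, eucl_norm (fun i => u l i 0) = 1) /\
  forall (k : nat), k \in [:: 0%N; 2%N; 4%N] ->
  forall p : mpoly.mpoly d R, all [pred mo | mpoly.mdeg mo == k] (mpoly.msupp p) ->
    (L%:R)^-1 * \sum_(l < L) mpoly.meval (fun i => u l i 0) p
    = sphere_integral (fun v => mpoly.meval v p).

Definition norm_2inf (m n : nat) (A : 'M[R]_(m, n)) : R :=
  \big[Num.max/0]_(i < m) eucl_norm (fun j => A i j).

Definition norm_inf (m : nat) (v : 'cV[R]_m) : R := \big[Num.max/0]_(i < m) `|v i 0|.

Definition median (s : seq R) : R :=
  let t := sort <=%R s in
  let N := size t in
  if odd N then t`_(N./2) else (t`_(N./2).-1 + t`_(N./2)) / 2.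

End Defs.

(* Main.v *)
Require Import Defs.
From HB Require Import structures.
From mathcomp Require Import all_boot all_order all_algebra.
From mathcomp Require Import all_classical all_reals all_analysis.
From mathcomp Require Import measurable_realfun.
From mathcomp Require mpoly.
From mathcomp Require Import zify ring lra.
Import (canonicals) mpoly.
Import Order.TTheory GRing.Theory Num.Theory.
Local Open Scope ring_scope.

(** The cone-measure integral over the ball is invariant under rotations, each
    plane rotation being a product of shears and each shear a translation in
    one variable. Hence the average of [(w . u)^k] over the design, [k = 2, 4],
    is [|w|^k] times that of [u_0^k]. The constants follow by summing over the
    standard basis, where [|u| = 1], and polarization then gives the averages of
    [(w . u)(v . u)] and [(w . u)^2 (v . u)^2]. So each coordinate of [y] has the
    right mean and variance at most [2 ||A||^2], and Chebyshev bounds by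
    [1 / (2 e^2)] the probability that a block mean misses by [gamma]. If the
    median misses, at least half of the blocks do; giving weight [e] to the bad
    blocks and [1/e] to the good ones, Markov's inequality bounds this by
    [(1/e + 1/(2e))^K <= e^(-K/2)], since [1 + 1/2 <= e^(1/2)]. A union bound
    over the [m] coordinates concludes. *)

(** * Rotation invariance in the plane *)

Section Rotation.
Variable R : realType.
Local Notation leb := (@lebesgue_measure R).
Local Open Scope ereal_scope.
Local Open Scope classical_set_scope.

(** Lebesgue measure is determined by its values on half-open intervals, and a translated interval
    keeps its length. *)
Lemma lebesgue_measureD (c : R) (A : set R) : measurable A ->
  pushforward leb (fun x : R => (x + c)%R : measurableTypeR R) A = leb A.
Proof.
have mc : measurable_fun setT (fun x : R => (x + c)%R : measurableTypeR R).
  exact: measurable_funD.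
move=> mA; apply/esym/lebesgue_measure_unique => //= _ [[a b]] _ <-.
have sub (x : R) : (x + c \in `]a, b])%R = (x \in `](a - c), (b - c)])%R.
  by rewrite !in_itv /= ltrBlDr lerBrDr.
transitivity (leb ([set` Interval (BRight (a - c)%R) (BRight (b - c)%R)] : set R)); last first.
  by congr (leb _); apply/seteqP; split => x xI; [exact: (eqbRL (sub x) xI) | exact: (eqbLR (sub x) xI)].
rewrite !lebesgue_measure_itv /= !lte_fin ltrD2r.
by case: ifP => // _; rewrite -!EFinD; congr EFin; ring.
Qed.

Lemma ge0_integral_translation (c : R) (f : R -> \bar R) :
  measurable_fun setT f -> (forall x, 0 <= f x) ->
  \int[leb]_x f (x + c)%R = \int[leb]_x f x.
Proof.
move=> mf f0.
have mc : measurable_fun setT (fun x : R => (x + c)%R : measurableTypeR R).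
  exact: measurable_funD.
transitivity (\int[pushforward leb (fun x : R => (x + c)%R : measurableTypeR R)]_x f x).
  by rewrite ge0_integral_pushforward //= preimage_setT.
by apply: eq_measure_integral => A mA _; exact: lebesgue_measureD.
Qed.

(** Tonelli's theorem makes [x] the inner variable; for fixed [y] the shear is then the translation
    by [t * y]. *)
Lemma ge0_integral2_shearl (t : R) (g : R * R -> \bar R) :
  measurable_fun setT g -> (forall x, 0 <= g x) ->
  \int[leb]_x \int[leb]_y g ((x + t * y)%R, y) =
  \int[leb]_x \int[leb]_y g (x, y).
Proof.
move=> mg g0.
have mg' : measurable_fun setT (fun z : R * R => g ((z.1 + t * z.2)%R, z.2)).
  apply: measurableT_comp => //; apply: measurable_fun_pair => //.
  apply: measurable_funD => //; exact: measurable_funM.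
rewrite (@fubini_tonelli _ _ _ _ _ leb leb _ mg') // (@fubini_tonelli _ _ _ _ _ leb leb _ mg) //.
apply: eq_integral => y _; apply: (ge0_integral_translation (t * y)%R (fun x => g (x, y))) => //.
exact: measurable_fun_pair1.
Qed.

Lemma ge0_integral2_shearr (t : R) (g : R * R -> \bar R) :
  measurable_fun setT g -> (forall x, 0 <= g x) ->
  \int[leb]_x \int[leb]_y g (x, (y + t * x)%R) =
  \int[leb]_x \int[leb]_y g (x, y).
Proof.
move=> mg g0.
apply: eq_integral => x _; apply: (ge0_integral_translation (t * x)%R (fun y => g (x, y))) => //.
exact: measurable_fun_pair2.
Qed.

(* A plane rotation other than the half-turn is a product of three shears. *)
Lemma ge0_integral2_rotation (c s : R) (g : R * R -> \bar R) :
  measurable_fun setT g -> (forall x, 0 <= g x) ->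
  (c ^+ 2 + s ^+ 2 = 1)%R -> (1 + c != 0)%R ->
  \int[leb]_x \int[leb]_y g ((c * x - s * y)%R, (s * x + c * y)%R) =
  \int[leb]_x \int[leb]_y g (x, y).
Proof.
(* Minus the tangent of half the rotation angle: the shears with coefficients [t], [s], [t] compose
   to the rotation. *)
move=> mg g0 cs c1; pose t : R := (- (s / (1 + c)))%R.
have msh1 : measurable_fun setT (fun z : R * R => ((z.1 + t * z.2)%R, z.2)).
  by apply: measurable_fun_pair => //; apply: measurable_funD => //; exact: measurable_funM.
have msh2 : measurable_fun setT (fun z : R * R => (z.1, (z.2 + s * z.1)%R)).
  by apply: measurable_fun_pair => //; apply: measurable_funD => //; exact: measurable_funM.
rewrite -(ge0_integral2_shearl t g) //.
rewrite -(ge0_integral2_shearr s (fun z => g ((z.1 + t * z.2)%R, z.2))) //=; last first.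
  exact: (measurableT_comp mg msh1).
rewrite -(ge0_integral2_shearl t
  (fun z => g ((z.1 + t * (z.2 + s * z.1))%R, (z.2 + s * z.1)%R))) //=; last first.
  exact: (measurableT_comp (measurableT_comp mg msh1) msh2).
apply: eq_integral => x _; apply: eq_integral => y _.
have ss : (s ^+ 2 = (1 - c) * (1 + c))%R by rewrite -[in RHS](mulr1 1%R); lra.
have tE : (1 + t * s = c)%R.
  by rewrite /t mulNr mulrAC -expr2 ss mulfK //; ring.
have sE : (2 * t + t ^+ 2 * s = - s)%R.
  have -> : (2 * t + t ^+ 2 * s = t * (1 + (1 + t * s)))%R by ring.
  by rewrite tE /t mulNr divfK.
congr (g (_, _)).
  by transitivity ((1 + t * s) * x + (2 * t + t ^+ 2 * s) * y)%R; [rewrite tE sE mulNr | ring].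
by transitivity (s * x + (1 + t * s) * y)%R; [rewrite tE | ring].
Qed.

End Rotation.

(** * Iterated integrals of functions of [|s|^2] and [w . s] *)

Section IteratedIntegrals.
Set Implicit Arguments.
Unset Strict Implicit.
Variable R : realType.
Local Notation leb := (@lebesgue_measure R).
Local Open Scope ereal_scope.
Local Open Scope classical_set_scope.

(** The rotation with cosine [a / b] and sine [- c / b] turns [b * x] into [a * x + c * y]. If
    [c = 0], nothing is rotated and [b = a] keeps its sign; otherwise [b > |a|], which excludes the
    half-turn. *)
Lemma ge0_integral2_linear_radial (a c : R) :
  exists2 b : R, (b ^+ 2 = a ^+ 2 + c ^+ 2)%R &
  forall G : R * R -> \bar R, measurable_fun setT G -> (forall x, 0 <= G x) ->
  \int[leb]_x \int[leb]_y G ((x ^+ 2 + y ^+ 2)%R, (a * x + c * y)%R) =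
  \int[leb]_x \int[leb]_y G ((x ^+ 2 + y ^+ 2)%R, (b * x)%R).
Proof.
have [->|c0] := eqVneq c 0%R.
  exists a; first by rewrite expr0n addr0.
  by move=> G _ _; apply: eq_integral => x _; apply: eq_integral => y _; rewrite mul0r addr0.
pose b := Num.sqrt (a ^+ 2 + c ^+ 2).
have b2 : (b ^+ 2 = a ^+ 2 + c ^+ 2)%R by rewrite sqr_sqrtr // addr_ge0 ?sqr_ge0.
have c2 : (0 < c ^+ 2)%R by rewrite exprn_even_gt0.
have a2 : (0 <= a ^+ 2)%R by rewrite sqr_ge0.
have b0 : (0 < b)%R by rewrite sqrtr_gt0; lra.
have ab : (b + a != 0)%R.
  apply/eqP => ba; have : (b ^+ 2 = a ^+ 2)%R by rewrite (_ : b = - a)%R ?sqrrN //; lra.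
  by rewrite b2 => /eqP; rewrite -subr_eq0 addrAC subrr add0r gt_eqF.
have cs : ((a / b) ^+ 2 + (- c / b) ^+ 2 = 1)%R.
  by rewrite !expr_div_n sqrrN -mulrDl -b2 divff // expf_neq0 // gt_eqF.
exists b => // G mG G0.
pose g (z : R * R) := G ((z.1 ^+ 2 + z.2 ^+ 2)%R, (b * z.1)%R).
have mg : measurable_fun setT g.
  apply: measurableT_comp => //; apply: measurable_fun_pair => //.
    by apply: measurable_funD; exact: measurable_funX.
  exact: measurable_funM.
apply: etrans (ge0_integral2_rotation _ _ _ g mg _ cs _) => //; last 2 first.
  by move=> z; exact: G0.
  by rewrite -{1}(divff (lt0r_neq0 b0)) -mulrDl mulf_neq0 // invr_neq0 // gt_eqF.
have bK : (b / b = 1)%R by rewrite divff // gt_eqF.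
apply: eq_integral => x _; apply: eq_integral => y _; rewrite /g /=; congr (G (_, _)).
  transitivity ((x ^+ 2 + y ^+ 2) * ((a / b) ^+ 2 + (- c / b) ^+ 2))%R; last by ring.
  by rewrite cs mulr1.
by transitivity ((a * x + c * y) * (b / b))%R; [rewrite bK mulr1 | ring].
Qed.

Definition dot (w : nat -> R) (s : seq R) : R := (\sum_(i < size s) w i * s`_i)%R.
Definition nrm2 (s : seq R) : R := (\sum_(i < size s) s`_i ^+ 2)%R.

Lemma dot_cons w x s : (dot w (x :: s) = w 0%N * x + dot (w \o S) s)%R.
Proof. by rewrite /dot /= big_ord_recl. Qed.

Lemma nrm2_cons x s : (nrm2 (x :: s) = x ^+ 2 + nrm2 s)%R.
Proof. by rewrite /nrm2 /= big_ord_recl. Qed.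

Lemma dot_nil w : dot w [::] = 0%R. Proof. exact: big_ord0. Qed.
Lemma nrm2_nil : nrm2 [::] = 0%R. Proof. exact: big_ord0. Qed.

Lemma nrm2_ge0 s : (0 <= nrm2 s)%R.
Proof. by apply: sumr_ge0 => i _; exact: sqr_ge0. Qed.

(** The extended-real twin of [iter_integral]: for nonnegative functions, Tonelli and monotonicity
    then need no integrability. *)
Fixpoint iter_eintegral (d : nat) (F : seq R -> \bar R) : \bar R :=
  if d is d'.+1 then \int[leb]_t iter_eintegral d' (fun s => F (t :: s)) else F [::].

Lemma iter_eintegralS d F :
  iter_eintegral d.+1 F = \int[leb]_t iter_eintegral d (fun s => F (t :: s)).
Proof. by []. Qed.

Lemma iter_eintegral_ge0 d F : (forall s, 0 <= F s) -> 0 <= iter_eintegral d F.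
Proof.
elim: d F => [|d IH] F F0 //=; apply: integral_ge0 => x _; exact: IH.
Qed.

Lemma iter_eintegral0 d : iter_eintegral d (fun=> 0) = 0.
Proof. by elim: d => //= d IH; rewrite IH integral0. Qed.

Lemma eq_iter_eintegral d F G : (forall s, size s = d -> F s = G s) ->
  iter_eintegral d F = iter_eintegral d G.
Proof.
elim: d F G => [|d IH] F G FG /=; first exact: FG.
by apply: eq_integral => x _; apply: IH => s ss; apply: FG; rewrite /= ss.
Qed.

Lemma eq_iter_integral d (F G : seq R -> R) : (forall s, size s = d -> F s = G s) ->
  iter_integral d F = iter_integral d G.
Proof.
elim: d F G => [|d IH] F G FG /=; first exact: FG.
by apply: eq_Rintegral => x _; apply: IH => s ss; apply: FG; rewrite /= ss.
Qed.

Section Shift.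
Context dsp (T : measurableType dsp).

(* Moves the outermost integration variable into the parameter, for inductions on
   the dimension with a varying parameter space. *)
Definition absorb (w0 : R) U (h : T * (R * R) -> U) (z : (T * R) * (R * R)) : U :=
  h (z.1.1, ((z.1.2 ^+ 2 + z.2.1)%R, (w0 * z.1.2 + z.2.2)%R)).

Lemma measurable_absorb w0 dU (U : measurableType dU) (h : T * (R * R) -> U) :
  measurable_fun setT h -> measurable_fun setT (absorb w0 h).
Proof.
move=> mh; apply: (measurableT_comp mh).
have m11 : measurable_fun setT (fun z : (T * R) * (R * R) => z.1.1) by exact: measurableT_comp.
have m12 : measurable_fun setT (fun z : (T * R) * (R * R) => z.1.2) by exact: measurableT_comp.
have m21 : measurable_fun setT (fun z : (T * R) * (R * R) => z.2.1) by exact: measurableT_comp.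
have m22 : measurable_fun setT (fun z : (T * R) * (R * R) => z.2.2) by exact: measurableT_comp.
apply: measurable_fun_pair => //; apply: measurable_fun_pair.
  by apply: measurable_funD => //; exact: measurable_funX.
by apply: measurable_funD => //; exact: measurable_funM.
Qed.

Lemma absorbE w U (h : T * (R * R) -> U) t x s :
  h (t, (nrm2 (x :: s), dot w (x :: s))) =
  absorb (w 0%N) h ((t, x), (nrm2 s, dot (w \o S) s)).
Proof. by rewrite /absorb /= nrm2_cons dot_cons. Qed.

End Shift.

(** By induction on [d], each integration preserving measurability by Tonelli. The parameter space
    grows from [T] to [T * R] at each step, hence the quantification over it. *)
Lemma measurable_iter_eintegral d w dsp (T : measurableType dsp)
    (h : T * (R * R) -> \bar R) :
  measurable_fun setT h -> (forall z, 0 <= h z) ->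
  measurable_fun setT (fun t => iter_eintegral d (fun s => h (t, (nrm2 s, dot w s)))).
Proof.
elim: d w dsp T h => [|d IH] w dsp T h mh h0 /=.
  by apply: measurableT_comp => //; exact: measurable_fun_pair.
pose f (z : T * R) := iter_eintegral d (fun s => absorb (w 0%N) h (z, (nrm2 s, dot (w \o S) s))).
have mf : measurable_fun setT f.
  apply: (IH (w \o S) _ _ (absorb (w 0%N) h)) => [|z]; [exact: measurable_absorb | exact: h0].
have f0 z : 0 <= f z by apply: iter_eintegral_ge0 => s; exact: h0.
have := measurable_fun_fubini_tonelli_F (m2 := leb) f mf f0.
congr measurable_fun; apply/funext => t; apply: eq_integral => x _.
by apply: eq_iter_eintegral => s _; rewrite absorbE.
Qed.

End IteratedIntegrals.

(** * Reduction of [w . s] to one coordinate; finiteness and positivity of ball integrals *)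

Section RadialIntegrals.
Set Implicit Arguments.
Unset Strict Implicit.
Variable R : realType.
Local Notation leb := (@lebesgue_measure R).
Local Open Scope ereal_scope.
Local Open Scope classical_set_scope.

(** By induction, the tail of [w . s] collapses to a multiple of its first coordinate, which a
    rotation of the first two coordinates merges with [w 0]. Since [b] does not depend on [h], the
    induction hypothesis covers all the functions obtained by freezing the first coordinate. *)
Lemma iter_eintegral_dot_radial d (w : nat -> R) :
  exists2 b : R, (b ^+ 2 = \sum_(i < d.+1) w i ^+ 2)%R &
  forall h : R * R -> \bar R, measurable_fun setT h -> (forall z, 0 <= h z) ->
  iter_eintegral d.+1 (fun s => h (nrm2 s, dot w s)) =
  iter_eintegral d.+1 (fun s => h (nrm2 s, (b * s`_0)%R)).
Proof.
elim: d w => [|d IH] w.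
  exists (w 0%N); first by rewrite big_ord_recl big_ord0 addr0.
  move=> h _ _; apply: eq_iter_eintegral => -[|x [|y s]] //= _.
  by rewrite dot_cons dot_nil addr0.
have [b1 b1E {}IH] := IH (w \o S).
have [b bE Hb] := ge0_integral2_linear_radial (w 0%N) b1.
exists b; first by rewrite bE b1E [RHS]big_ord_recl.
move=> h mh h0.
pose G (z : R * R) := iter_eintegral d (fun s => h ((z.1 + nrm2 s)%R, z.2)).
have mG : measurable_fun setT G.
  pose h' (z : (R * R) * (R * R)) := h ((z.1.1 + z.2.1)%R, z.1.2).
  apply: (@measurable_iter_eintegral _ d w _ _ h') => [|z]; last exact: h0.
  apply: (measurableT_comp mh); apply: measurable_fun_pair.
    by apply: measurable_funD; exact: measurableT_comp.
  exact: measurableT_comp.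
have G0 z : 0 <= G z by apply: iter_eintegral_ge0.
transitivity (\int[leb]_x \int[leb]_y G ((x ^+ 2 + y ^+ 2)%R, (w 0%N * x + b1 * y)%R)).
  rewrite iter_eintegralS; apply: eq_integral => x _.
  pose h1 (z : R * R) := h ((x ^+ 2 + z.1)%R, (w 0%N * x + z.2)%R).
  have mh1 : measurable_fun setT h1.
    apply: (measurableT_comp mh); apply: measurable_fun_pair.
      by apply: measurable_funD => //; exact: measurableT_comp.
    by apply: measurable_funD => //; exact: measurableT_comp.
  transitivity (iter_eintegral d.+1 (fun s => h1 (nrm2 s, dot (w \o S) s))).
    by apply: eq_iter_eintegral => s _; rewrite nrm2_cons dot_cons.
  rewrite IH //; last by move=> z; exact: h0.
  rewrite iter_eintegralS; apply: eq_integral => y _; apply: eq_iter_eintegral => s _.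
  by rewrite /h1 /= nrm2_cons addrA.
rewrite Hb //; apply: eq_integral => x _; apply: eq_integral => y _.
by apply: eq_iter_eintegral => s _; rewrite /= !nrm2_cons addrA.
Qed.

Lemma measurable_iter_eintegral_cons d w dsp (T : measurableType dsp) (h : T * (R * R) -> \bar R) t :
  measurable_fun setT h -> (forall z, 0 <= h z) ->
  measurable_fun setT (fun x : R =>
    iter_eintegral d (fun s => h (t, (nrm2 (x :: s), dot w (x :: s))))).
Proof.
move=> mh h0.
have mah := @measurable_iter_eintegral _ d (w \o S) _ _ _ (measurable_absorb (w 0%N) mh).
have /(measurable_fun_pair2 t) := mah (fun z => h0 _).
congr measurable_fun; apply/funext => x.
by apply: eq_iter_eintegral => s _; rewrite absorbE.
Qed.

Lemma le_iter_eintegral d w dsp (T : measurableType dsp) (h1 h2 : T * (R * R) -> \bar R) t :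
  measurable_fun setT h1 -> measurable_fun setT h2 ->
  (forall z, 0 <= h1 z) -> (forall z, h1 z <= h2 z) ->
  iter_eintegral d (fun s => h1 (t, (nrm2 s, dot w s))) <=
  iter_eintegral d (fun s => h2 (t, (nrm2 s, dot w s))).
Proof.
elim: d w dsp T h1 h2 t => [|d IH] w dsp T h1 h2 t mh1 mh2 h10 h12; first exact: h12.
have h20 z : 0 <= h2 z by exact: le_trans (h10 z) (h12 z).
rewrite !iter_eintegralS; apply: ge0_le_integral => //.
- by move=> x _; apply: iter_eintegral_ge0.
- exact: measurable_iter_eintegral_cons.
- exact: measurable_iter_eintegral_cons.
move=> x _.
under eq_iter_eintegral do rewrite absorbE.
under [leRHS]eq_iter_eintegral do rewrite absorbE.
apply: IH => [||z|z]; by [exact: measurable_absorb | exact: h10 | exact: h12].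
Qed.

(** A real integral agrees with the extended one only where the latter is finite, so finiteness is
    carried along: the support in the unit ball confines each variable to [-1, 1], and each
    integration costs at most a factor 2. *)
Lemma iter_integralE d w dsp (T : measurableType dsp) (h : T * (R * R) -> R) (M : R) :
  measurable_fun setT h -> (forall z, (0 <= h z)%R) ->
  (forall t s, size s = d -> (h (t, (nrm2 s, dot w s)) <= M)%R) ->
  (forall t s, size s = d -> (1 < nrm2 s)%R -> h (t, (nrm2 s, dot w s)) = 0%R) ->
  forall t, (iter_integral d (fun s => h (t, (nrm2 s, dot w s))))%:E =
    iter_eintegral d (fun s => (h (t, (nrm2 s, dot w s)))%:E) /\
    iter_eintegral d (fun s => (h (t, (nrm2 s, dot w s)))%:E) <= (M * 2 ^+ d)%:E.
Proof.
elim: d w dsp T h => [|d IH] w dsp T h mh h0 hM hs t.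
  by split => //=; rewrite expr0 mulr1 lee_fin; exact: (hM t [::]).
have M0 : (0 <= M)%R.
  by apply: le_trans (h0 _) (hM t (nseq d.+1 0%R) _); rewrite size_nseq.
have {}IH := IH (w \o S) _ _ _ (measurable_absorb (w 0%N) mh) (fun z => h0 _).
have {}IH x : (iter_integral d (fun s => h (t, (nrm2 (x :: s), dot w (x :: s)))))%:E =
    iter_eintegral d (fun s => (h (t, (nrm2 (x :: s), dot w (x :: s))))%:E) /\
    iter_eintegral d (fun s => (h (t, (nrm2 (x :: s), dot w (x :: s))))%:E) <= (M * 2 ^+ d)%:E.
  rewrite (eq_iter_integral (fun s _ => absorbE w h t x s)).
  rewrite (eq_iter_eintegral (fun s _ => congr1 EFin (absorbE w h t x s))).
  apply: IH => -[t' x'] s ss; rewrite -absorbE => //.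
    by apply: hM; rewrite /= ss.
  move=> ns; apply: hs; first by rewrite /= ss.
  by rewrite nrm2_cons; apply: lt_le_trans ns _; rewrite lerDr sqr_ge0.
set E := fun x : R => iter_eintegral d (fun s => (h (t, (nrm2 (x :: s), dot w (x :: s))))%:E).
have mE : measurable_fun setT E.
  apply: (measurable_iter_eintegral_cons _ _ (h := EFin \o h)) => [|z]; last by rewrite lee_fin.
  exact/measurable_EFinP.
have E0 x : 0 <= E x by apply: iter_eintegral_ge0 => s; rewrite lee_fin.
have Esupp : \int[leb]_x E x = \int[leb]_(x in `[(-1)%R, 1%R]) E x.
  rewrite [RHS]integral_mkcond; apply: eq_integral => x _; rewrite patchE.
  case: ifPn => // /negP xI.
  apply: etrans (iter_eintegral0 R d); apply: eq_iter_eintegral => s ss.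
  rewrite hs //= ?ss // nrm2_cons.
  have x1 : (1 < x ^+ 2)%R.
    rewrite ltNge; apply/negP => x1; apply: xI; rewrite inE /= in_itv /=.
    by rewrite -ler_norml -(expr_le1 (n := 2)) // real_normK // num_real.
  by apply: lt_le_trans x1 _; rewrite lerDl nrm2_ge0.
have Ele : \int[leb]_x E x <= (M * 2 ^+ d.+1)%:E.
  rewrite Esupp; apply: (@le_trans _ _ (\int[leb]_(x in `[(-1)%R, 1%R]) (cst (M * 2 ^+ d)%:E) x)).
    apply: ge0_le_integral => //; first exact: measurable_funTS.
    by move=> x _; exact: (IH x).2.
  rewrite integral_cst //= lebesgue_measure_itv /= lte_fin ifT; last by lra.
  by rewrite -!EFinD -EFinM lee_fin exprSr mulrA; lra.
split => //=; rewrite /Rintegral.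
under eq_integral do rewrite (IH _).1.
rewrite fineK // ge0_fin_numE ?integral_ge0 //.
  exact: le_lt_trans Ele (ltry _).
by move=> x _; exact: E0.
Qed.

(** Induction on [d] with [r] varying: for a first coordinate in [[0, sqrt (r / 2)]], the slice
    contains the ball of squared radius [r / 2]. *)
Lemma iter_eintegral_ball_gt0 d (r : R) : (0 < r)%R ->
  0 < iter_eintegral d (fun s => (if (nrm2 s <= r)%R then 1%R else 0%R)%:E).
Proof.
elim: d r => [|d IH] r r0; first by rewrite /= nrm2_nil ltW // lte_fin.
pose h (z : R * (R * R)) : \bar R := (if (z.2.1 <= r - z.1)%R then 1%R else 0%R)%:E.
have mh : measurable_fun setT h.
  apply/measurable_EFinP; apply: measurable_fun_ifT => //.
  apply: measurable_fun_ler; first exact: measurableT_comp.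
  by apply: measurable_funB => //; exact: measurableT_comp.
have h0 z : 0 <= h z by rewrite /h; case: ifP; rewrite lee_fin.
pose E x : \bar R := iter_eintegral d (fun s => h (0%R, (nrm2 (x :: s), dot (fun=> 0%R) (x :: s)))).
have EE : iter_eintegral d.+1 (fun s => (if (nrm2 s <= r)%R then 1%R else 0%R)%:E) = \int[leb]_x E x.
  rewrite iter_eintegralS; apply: eq_integral => x _; apply: eq_iter_eintegral => s _.
  by rewrite /h /= subr0.
have mE : measurable_fun setT E by exact: measurable_iter_eintegral_cons.
have E0 x : 0 <= E x by exact: iter_eintegral_ge0.
pose e := Num.sqrt (r / 2).
have e0 : (0 < e)%R by rewrite sqrtr_gt0 divr_gt0.
have r20 : (0 < r / 2)%R by rewrite divr_gt0.
pose c : \bar R := iter_eintegral d (fun s => (if (nrm2 s <= r / 2)%R then 1%R else 0%R)%:E).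
have c0 : 0 < c by exact: IH.
rewrite EE; apply: (@lt_le_trans _ _ (\int[leb]_(x in `[0%R, e]) (cst c) x)).
  by rewrite integral_cst //= lebesgue_measure_itv /= lte_fin e0 sube0 mule_gt0 // lte_fin.
apply: (@le_trans _ _ (\int[leb]_(x in `[0%R, e]) E x)); last first.
  exact: ge0_subset_integral.
apply: ge0_le_integral => //.
- by move=> x _; exact: ltW.
- exact: measurable_funTS.
move=> x /=; rewrite in_itv /= => /andP[x0 xe].
have xr : (x ^+ 2 <= r / 2)%R.
  by rewrite -[leRHS]sqr_sqrtr; [rewrite ler_sqr ?nnegrE // sqrtr_ge0 | exact: ltW].
have mh' a : measurable_fun setT (fun z : R * (R * R) => h (a, z.2)).
  by apply: (measurableT_comp mh); exact: measurable_fun_pair.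
have -> : c = iter_eintegral d (fun s => h ((r / 2)%R, (nrm2 s, dot (fun=> 0%R) s))).
  apply: eq_iter_eintegral => s _; rewrite /h /=.
  by rewrite (_ : (r - r / 2 = r / 2)%R) //; lra.
have -> : E x = iter_eintegral d (fun s => h ((x ^+ 2)%R, (nrm2 s, dot (fun=> 0%R) s))).
  apply: eq_iter_eintegral => s _; rewrite /h /= nrm2_cons subr0.
  by rewrite lerBrDl.
have le := le_iter_eintegral d (fun=> 0%R) (0%R : R) (mh' (r / 2)%R) (mh' (x ^+ 2)%R).
apply: le => z; first exact: h0.
rewrite /h /= lee_fin; case: ifP => [zr|_]; last by case: ifP.
by rewrite ifT //; lra.
Qed.

End RadialIntegrals.

(** * Moments of the design *)

Section Sphere.
Set Implicit Arguments.
Unset Strict Implicit.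
Variable R : realType.
Local Open Scope classical_set_scope.

Definition linear_form d (w : 'I_d -> R) : mpoly.mpoly d R :=
  \sum_i w i *: @mpoly.mpolyX d R (mpoly.mnm1 i).

Lemma meval_linear_form_exp d (w v : 'I_d -> R) k :
  mpoly.meval v (linear_form w ^+ k) = (\sum_i w i * v i) ^+ k.
Proof.
rewrite rmorphXn /= /linear_form raddf_sum /=; congr (_ ^+ _).
by apply: eq_bigr => i _; rewrite mpoly.mevalZ mpoly.mevalXU.
Qed.

Lemma linear_form_exp_homog d (w : 'I_d -> R) k :
  all [pred mo | mpoly.mdeg mo == k] (mpoly.msupp (linear_form w ^+ k)).
Proof.
suff : linear_form w \is mpoly.ishomog1 1 (mpoly.mpoly_mdeg__canonical__mpoly_Measure d).
  by move=> /(mpoly.dhomogMn k); rewrite mul1n.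
apply: rpred_sum => i _; apply: rpredZ; rewrite mpoly.dhomogX.
by rewrite /= mpoly.mdeg1.
Qed.

(** Cauchy-Schwarz, from Lagrange's identity: twice the gap is the sum of the squares
    [(a i * b j - a j * b i) ^+ 2]. *)
Lemma sqr_sum_mul_le (I : finType) (a b : I -> R) :
  (\sum_i a i * b i) ^+ 2 <= (\sum_i a i ^+ 2) * (\sum_i b i ^+ 2).
Proof.
rewrite -subr_ge0 -(pmulr_rge0 _ (ltr0Sn R 1)).
have -> : 2%:R * ((\sum_i a i ^+ 2) * (\sum_i b i ^+ 2) - (\sum_i a i * b i) ^+ 2) =
    \sum_i \sum_j (a i * b j - a j * b i) ^+ 2.
  transitivity (\sum_i \sum_j (a i ^+ 2 * b j ^+ 2) + \sum_i \sum_j (a j ^+ 2 * b i ^+ 2)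
      - 2 * \sum_i \sum_j (a i * b i) * (a j * b j)).
    rewrite [X in _ + X - _]exchange_big /=.
    rewrite -!big_distrlr /=; ring.
  rewrite -big_split mulr_sumr -sumrB; apply: eq_bigr => i _.
  rewrite -big_split mulr_sumr -sumrB; apply: eq_bigr => j _ /=; ring.
by apply: sumr_ge0 => i _; apply: sumr_ge0 => j _; exact: sqr_ge0.
Qed.

(* [z] stands for [(|s|^2, w . s)]; for [|s| > 0], [z.1 `^ (- 2^-1)] is [1 / |s|]. *)
Definition ball_form k (z : R * R) : R :=
  (if z.1 <= 1 then 1 else 0) * (z.2 * z.1 `^ (- 2^-1)) ^+ k.*2.

Lemma ball_form_ge0 k z : 0 <= ball_form k z.
Proof.
apply: mulr_ge0; first by case: ifP.
by rewrite -muln2 mulnC exprM exprn_ge0 // sqr_ge0.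
Qed.

Lemma measurable_ball_form k : measurable_fun setT (ball_form k).
Proof.
apply: measurable_funM.
  by apply: measurable_fun_ifT => //; exact: measurable_fun_ler.
apply: measurable_funX; apply: measurable_funM; first by [].
by apply: (@measurableT_comp _ _ _ _ _ _ (@powR R ^~ (- 2^-1))).
Qed.

Lemma ball_form_le k p q W : 0 <= p -> 0 <= W -> q ^+ 2 <= W * p ->
  ball_form k (p, q) <= W ^+ k.
Proof.
move=> p0 W0 qW; rewrite /ball_form /=.
have qpW : (q * p `^ (- 2^-1)) ^+ 2 <= W.
  rewrite powRN powR12_sqrt // exprMn exprVn sqr_sqrtr //.
  (* At the origin the inverse of 0 is 0, so the square vanishes. *)
  have [->|pn0] := eqVneq p 0; first by rewrite invr0 mulr0.
  by rewrite ler_pdivrMr // lt_def pn0.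
rewrite -muln2 mulnC exprM; case: ifP => _; last by rewrite mul0r exprn_ge0.
by rewrite mul1r lerXn2r // nnegrE // sqr_ge0.
Qed.

(** By Cauchy-Schwarz the integrand is at most [|w|^(2k)], and it vanishes off the ball, so the
    integral is finite. The parameter of the general lemma is a dummy real. *)
Lemma ball_integralE d k (w : nat -> R) :
  (iter_integral d (fun s => ball_form k (nrm2 s, dot w s)))%:E =
  iter_eintegral d (fun s => (ball_form k (nrm2 s, dot w s))%:E).
Proof.
pose h (z : R * (R * R)) := ball_form k z.2.
have mh : measurable_fun setT h by apply: measurableT_comp => //; exact: measurable_ball_form.
apply: (proj1 (@iter_integralE R d w _ _ h ((\sum_(i < d) w i ^+ 2) ^+ k) mh _ _ _ (0 : R))) => [z|t s ss|t s _ s1].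
- exact: ball_form_ge0.
- apply: ball_form_le; first exact: nrm2_ge0.
    by apply: sumr_ge0 => i _; exact: sqr_ge0.
  by rewrite /dot /nrm2 ss; exact: sqr_sum_mul_le.
by rewrite /h /ball_form /= leNgt s1 mul0r.
Qed.

Lemma ball_integral_radial d k (w : nat -> R) :
  exists2 b : R, b ^+ 2 = \sum_(i < d.+1) w i ^+ 2 &
  iter_integral d.+1 (fun s => ball_form k (nrm2 s, dot w s)) =
  iter_integral d.+1 (fun s => ball_form k (nrm2 s, b * s`_0)).
Proof.
have [b bE Hb] := iter_eintegral_dot_radial d w.
exists b => //; apply: EFin_inj.
(* The right-hand integrand is also of dot-product form, with weights [(b, 0, 0, ...)], so the
   finiteness result covers it too. *)
pose w' i : R := if i is 0%N then b else 0.
have w'E s : size s = d.+1 -> b * s`_0 = dot w' s.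
  case: s => // x s _; rewrite dot_cons /= {1}/dot big1 ?addr0 // => i _.
  by rewrite mul0r.
have -> : iter_integral d.+1 (fun s => ball_form k (nrm2 s, b * s`_0)) =
    iter_integral d.+1 (fun s => ball_form k (nrm2 s, dot w' s)).
  by apply: eq_iter_integral => s ss; rewrite w'E.
rewrite !ball_integralE (Hb (EFin \o ball_form k)).
- by apply: eq_iter_eintegral => s ss; rewrite /= w'E.
- by apply/measurable_EFinP; exact: measurable_ball_form.
by move=> z; rewrite lee_fin ball_form_ge0.
Qed.

Lemma iter_integral_ball_gt0 d :
  0 < iter_integral d (fun s : seq R => if nrm2 s <= 1 then 1 else 0).
Proof.
have bE s : ball_form 0 (nrm2 s, dot (fun=> 0) s) = if nrm2 s <= 1 then 1 else 0.
  by rewrite /ball_form expr0 mulr1.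
rewrite -lte_fin -(eq_iter_integral (fun s _ => bE s)) ball_integralE.
by under eq_iter_eintegral do rewrite bE; exact: iter_eintegral_ball_gt0.
Qed.

Lemma eucl_norm_nth (d : nat) (s : seq R) : size s = d ->
  eucl_norm (fun i : 'I_d => s`_i) = Num.sqrt (nrm2 s).
Proof. by move=> <-. Qed.

Lemma sphere_integral_linear_form d k (w : 'I_d.+1 -> R) :
  sphere_integral (fun v => mpoly.meval v (linear_form w ^+ k.*2)) =
  iter_integral d.+1 (fun s => ball_form k (nrm2 s, dot (w \o inord) s)) /
  iter_integral d.+1 (fun s => if nrm2 s <= 1 then 1 else 0).
Proof.
have n1 (s : seq R) : size s = d.+1 ->
    (eucl_norm (fun i : 'I_d.+1 => s`_i) <= 1) = (nrm2 s <= 1).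
  by move=> ss; rewrite eucl_norm_nth // -[X in _ <= X]sqrtr1 ler_sqrt.
rewrite /sphere_integral; congr (_ / _); last first.
  by apply: eq_iter_integral => s ss; rewrite n1.
apply: eq_iter_integral => s ss; rewrite n1 // /ball_form /=; congr (_ * _).
rewrite meval_linear_form_exp; congr (_ ^+ _).
rewrite eucl_norm_nth // powRN powR12_sqrt ?nrm2_ge0 // /dot ss mulr_suml.
by apply: eq_bigr => i _; rewrite /= inord_val mulrA.
Qed.

(** The design property makes the average a sphere integral, which by rotation is the same for [w]
    as for [b] times the first basis vector, where [b ^+ 2 = |w|^2]. Read back on the design, this
    is the claim; no sphere moment is computed. *)
Lemma design_moment d L (u : 'I_L -> 'cV[R]_d.+1) k (w : 'I_d.+1 -> R) :
  projective_2design u -> k.*2 \in [:: 0; 2; 4]%N ->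
  (L%:R)^-1 * \sum_l (\sum_i w i * u l i 0) ^+ k.*2 =
  (\sum_i w i ^+ 2) ^+ k * ((L%:R)^-1 * \sum_l u l ord0 0 ^+ k.*2).
Proof.
move=> [_ hu] k024.
have mE (w' : 'I_d.+1 -> R) : (L%:R)^-1 * \sum_l (\sum_i w' i * u l i 0) ^+ k.*2 =
    sphere_integral (fun v => mpoly.meval v (linear_form w' ^+ k.*2)).
  rewrite -(hu _ k024) ?linear_form_exp_homog //.
  by under [in RHS]eq_bigr do rewrite meval_linear_form_exp.
have [b bE Hb] := ball_integral_radial d k (w \o inord).
pose w' (i : 'I_d.+1) : R := if i == ord0 then b else 0.
have w'E (v : 'I_d.+1 -> R) : \sum_i w' i * v i = b * v ord0.
  rewrite (bigD1 ord0) //= big1 ?addr0 /w' ?eqxx // => i /negPf ->.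
  by rewrite mul0r.
rewrite mE sphere_integral_linear_form Hb.
transitivity ((L%:R)^-1 * \sum_l (\sum_i w' i * u l i 0) ^+ k.*2).
  rewrite mE sphere_integral_linear_form; congr (_ / _).
  apply: eq_iter_integral => s ss; congr (ball_form _ (_, _)).
  rewrite /dot ss (eq_bigr (fun i : 'I_d.+1 => w' i * s`_i)) ?w'E // => i _.
  by rewrite /= inord_val.
under eq_bigr do rewrite w'E exprMn.
rewrite -mulr_sumr mulrCA; congr (_ * _).
rewrite -mul2n exprM bE; congr (_ ^+ _); apply: eq_bigr => i _.
by rewrite /= inord_val.
Qed.

(** For [L = 0] the average of the constant polynomial 1 would be 0, whereas its sphere integral is
    a positive volume divided by itself. *)
Lemma design_size_gt0 d L (u : 'I_L -> 'cV[R]_d) : projective_2design u -> (0 < L)%N.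
Proof.
move=> [_ /(_ 0%N isT) hu]; rewrite lt0n; apply/eqP => L0.
have := hu (linear_form (fun=> 0) ^+ 0) (linear_form_exp_homog _ _).
rewrite {1}L0 invr0 mul0r /sphere_integral => /esym/eqP.
rewrite mulf_eq0 invr_eq0.
have n1 (s : seq R) : size s = d ->
    (eucl_norm (fun i : 'I_d => s`_i) <= 1) = (nrm2 s <= 1).
  by move=> ss; rewrite eucl_norm_nth // -[X in _ <= X]sqrtr1 ler_sqrt.
have VE : iter_integral d (fun s => if eucl_norm (fun i : 'I_d => s`_i) <= 1 then 1 else 0) =
    iter_integral d (fun s : seq R => if nrm2 s <= 1 then 1 else 0 : R).
  by apply: eq_iter_integral => s ss; rewrite n1.
under eq_iter_integral do rewrite meval_linear_form_exp expr0 mulr1.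
by rewrite VE !gt_eqF ?iter_integral_ball_gt0.
Qed.

End Sphere.

(** * Second and fourth moments of the design; mean and variance of one sample *)

Section Moments.
Set Implicit Arguments.
Unset Strict Implicit.
Variable R : realType.

Definition inner d (w v : 'I_d -> R) : R := \sum_i w i * v i.

Lemma innerC d (w v : 'I_d -> R) : inner w v = inner v w.
Proof. by apply: eq_bigr => i _; rewrite mulrC. Qed.

Lemma innerDl d (w w' v : 'I_d -> R) : inner (w \+ w') v = inner w v + inner w' v.
Proof. by rewrite -big_split; apply: eq_bigr => i _; rewrite mulrDl. Qed.

Lemma innerBl d (w w' v : 'I_d -> R) : inner (w \- w') v = inner w v - inner w' v.
Proof. by rewrite -sumrB; apply: eq_bigr => i _; rewrite mulrBl. Qed.

Lemma innerDr d (w v v' : 'I_d -> R) : inner w (v \+ v') = inner w v + inner w v'.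
Proof. by rewrite innerC innerDl !(innerC w). Qed.

Lemma innerBr d (w v v' : 'I_d -> R) : inner w (v \- v') = inner w v - inner w v'.
Proof. by rewrite innerC innerBl !(innerC w). Qed.

Lemma inner_deltal d (i : 'I_d) (v : 'I_d -> R) : inner (fun j => (j == i)%:R) v = v i.
Proof.
rewrite /inner (bigD1 i) //= eqxx mul1r big1 ?addr0 // => j /negPf ->.
by rewrite mul0r.
Qed.

Section Design.
Variables (d L : nat) (u : 'I_L -> 'cV[R]_d.+1).
Hypothesis hu : projective_2design u.

Let avg (F : 'I_L -> R) : R := (L%:R)^-1 * \sum_l F l.
Let S (w : 'I_d.+1 -> R) l : R := inner w (fun i => u l i 0).
Let D : R := d.+1%:R.

Let L0 : L%:R != 0 :> R. Proof. by rewrite pnatr_eq0 -lt0n (design_size_gt0 hu). Qed.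

Let D0 : 0 < D. Proof. by rewrite ltr0n. Qed.

Let eq_avg F G : F =1 G -> avg F = avg G.
Proof. by move=> FG; congr (_ * _); apply: eq_bigr => l _. Qed.

Let avgZ c F : avg (fun l => c * F l) = c * avg F.
Proof. by rewrite /avg -mulr_sumr mulrCA. Qed.

Let avgD F G : avg (fun l => F l + G l) = avg F + avg G.
Proof. by rewrite /avg big_split mulrDr. Qed.

Let avgB F G : avg (fun l => F l - G l) = avg F - avg G.
Proof. by rewrite /avg sumrB mulrBr. Qed.

Let avg_sum (I : finType) (F : I -> 'I_L -> R) :
  avg (fun l => \sum_i F i l) = \sum_i avg (F i).
Proof. by rewrite /avg exchange_big mulr_sumr. Qed.

Let avg1 : avg (fun=> 1) = 1.
Proof. by rewrite /avg sumr_const card_ord mulVf. Qed.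

Let unit_norm l : \sum_i u l i 0 ^+ 2 = 1.
Proof.
have /(congr1 (fun x => x ^+ 2)) := hu.1 l.
by rewrite /eucl_norm sqr_sqrtr ?expr1n // sumr_ge0 // => i _; exact: sqr_ge0.
Qed.

Let S_delta i l : S (fun j => (j == i)%:R) l = u l i 0.
Proof. exact: inner_deltal. Qed.

Let inner_delta (i j : 'I_d.+1) :
  inner (fun k => (k == i)%:R) (fun k => (k == j)%:R) = (i == j)%:R.
Proof. by rewrite inner_deltal. Qed.

Let SD w v l : S (w \+ v) l = S w l + S v l. Proof. exact: innerDl. Qed.
Let SB w v l : S (w \- v) l = S w l - S v l. Proof. exact: innerBl. Qed.

Let moment k w : k.*2 \in [:: 0; 2; 4]%N ->
  avg (fun l => S w l ^+ k.*2) = inner w w ^+ k * avg (fun l => u l ord0 0 ^+ k.*2).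
Proof.
by move=> k024; rewrite /avg (design_moment w hu k024); congr (_ ^+ _ * _).
Qed.

Lemma design_second_moment w v : avg (fun l => S w l * S v l) = inner w v / D.
Proof.
set s := avg (fun l => u l ord0 0 ^+ 2).
have Q w' : avg (fun l => S w' l ^+ 2) = inner w' w' * s.
  by have := @moment 1 w' isT; rewrite expr1.
have P w' v' : avg (fun l => S w' l * S v' l) = inner w' v' * s.
  (* Polarization: [4 a b = (a + b)^2 - (a - b)^2]. *)
  transitivity (avg (fun l => 4^-1 * (S (w' \+ v') l ^+ 2 - S (w' \- v') l ^+ 2))).
    by apply: eq_avg => l; rewrite SD SB; field.
  rewrite avgZ avgB !Q !(innerDl, innerDr, innerBl, innerBr) (innerC v' w'); by field.
have : \sum_i avg (fun l => u l i 0 ^+ 2) = 1.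
  by rewrite -avg_sum -[RHS]avg1; apply: eq_avg => l; exact: unit_norm.
rewrite (eq_bigr (fun=> s)) => [|i _]; last first.
  transitivity (avg (fun l => S (fun j => (j == i)%:R) l ^+ 2)).
    by apply: eq_avg => l; rewrite S_delta.
  by rewrite Q inner_delta eqxx mul1r.
rewrite sumr_const card_ord -mulr_natl => Ds.
by rewrite P; congr (_ * _); apply: (mulfI (lt0r_neq0 D0)); rewrite Ds divff // gt_eqF.
Qed.

Lemma design_fourth_moment w v :
  avg (fun l => S w l ^+ 2 * S v l ^+ 2) =
  (inner w w * inner v v + 2 * inner w v ^+ 2) / (D * (D + 2)).
Proof.
set s := avg (fun l => u l ord0 0 ^+ 4).
have Q w' : avg (fun l => S w' l ^+ 4) = inner w' w' ^+ 2 * s by exact: (@moment 2 w' isT).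
have P w' v' : avg (fun l => S w' l ^+ 2 * S v' l ^+ 2) =
    (inner w' w' * inner v' v' + 2 * inner w' v' ^+ 2) * (s / 3).
  (* Polarization: [12 a^2 b^2 = (a + b)^4 + (a - b)^4 - 2 a^4 - 2 b^4]. *)
  transitivity (avg (fun l => 12^-1 * ((S (w' \+ v') l ^+ 4 + S (w' \- v') l ^+ 4)
      - 2 * (S w' l ^+ 4 + S v' l ^+ 4)))).
    by apply: eq_avg => l; rewrite SD SB; field.
  rewrite avgZ avgB avgZ !avgD !Q !(innerDl, innerDr, innerBl, innerBr) (innerC v' w'); by field.
have : \sum_i \sum_j avg (fun l => u l i 0 ^+ 2 * u l j 0 ^+ 2) = 1.
  under eq_bigr do rewrite -avg_sum.
  rewrite -avg_sum -[RHS]avg1; apply: eq_avg => l.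
  by under eq_bigr do rewrite -mulr_sumr unit_norm mulr1; exact: unit_norm.
(* On basis vectors [P] gives [(1 + 2 [i = j]) * (s / 3)]. The sum over all pairs is also the
   average of [|u l|^4], that is 1, which fixes [s]. *)
have -> : \sum_i \sum_j avg (fun l => u l i 0 ^+ 2 * u l j 0 ^+ 2) = D * (D + 2) * (s / 3).
  transitivity (\sum_(i < d.+1) (D + 2) * (s / 3)); last first.
    by rewrite sumr_const card_ord -[LHS]mulr_natl mulrA.
  apply: eq_bigr => i _.
  transitivity (\sum_(j < d.+1) (1 + 2 * (j == i)%:R) * (s / 3)).
    apply: eq_bigr => j _.
    transitivity (avg (fun l => S (fun k => (k == i)%:R) l ^+ 2 * S (fun k => (k == j)%:R) l ^+ 2)).
      by apply: eq_avg => l; rewrite !S_delta.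
    by rewrite P !inner_delta !eqxx mulr1 eq_sym; case: eqP => _; rewrite ?expr1n ?expr0n.
  rewrite -mulr_suml big_split /= -mulr_sumr sumr_const card_ord.
  by rewrite (bigD1 i) //= eqxx big1 ?addr0 ?mulr1 // => j /negPf ->.
move=> Ds; rewrite P; congr (_ * _).
have DD : D * (D + 2) != 0 by rewrite gt_eqF // mulr_gt0 // addr_gt0.
by apply: (mulfI DD); rewrite Ds divff.
Qed.

Lemma design_sample_mean a x : avg (fun l => D * S a l * S x l) = inner a x.
Proof.
under eq_avg do rewrite -mulrA.
by rewrite avgZ design_second_moment mulrC divfK // gt_eqF.
Qed.

Lemma design_sample_variance a x : inner x x = 1 ->
  avg (fun l => (D * S a l * S x l - inner a x) ^+ 2) <= 2 * inner a a.
Proof.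
move=> x1; set mu := inner a x.
have muE : mu ^+ 2 <= inner a a.
  have : mu ^+ 2 <= inner a a * inner x x := sqr_sum_mul_le a x.
  by rewrite x1 mulr1.
have -> : avg (fun l => (D * S a l * S x l - mu) ^+ 2) =
    avg (fun l => D ^+ 2 * (S a l ^+ 2 * S x l ^+ 2) - (2 * mu * (D * S a l * S x l) - mu ^+ 2 * 1)).
  by apply: eq_avg => l; ring.
rewrite !avgB !avgZ design_fourth_moment design_sample_mean avg1 x1 -/mu.
rewrite !mulr1.
have -> : D ^+ 2 * ((inner a a + 2 * mu ^+ 2) / (D * (D + 2))) = D * (inner a a + 2 * mu ^+ 2) / (D + 2).
  by field; rewrite !gt_eqF // addr_gt0.
rewrite lerBlDr ler_pdivrMr ?addr_gt0 //.
(* What remains is [D mu^2 <= D |a|^2 + 4 |a|^2 + 2 mu^2], a consequence of [mu^2 <= |a|^2]. *)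
have mu0 := sqr_ge0 mu; move: D0 muE mu0; nra.
Qed.

End Design.
End Moments.

(** * Tails of medians of means *)

Section Tails.
Set Implicit Arguments.
Unset Strict Implicit.
Variable R : realType.

(** Additivity of variance in counting form: the functions [g] are the outcomes of [#|I|]
    independent uniform draws, and for [i != j] the cross term has a factor [\sum_t Z t = 0]. *)
Lemma sum_ffun_sqr (I T : finType) (Z : T -> R) : (0 < #|T|)%N -> \sum_t Z t = 0 ->
  \sum_(g : {ffun I -> T}) (\sum_i Z (g i)) ^+ 2 =
  #|I|%:R * #|T|%:R ^+ #|I| * (#|T|%:R^-1 * \sum_t Z t ^+ 2).
Proof.
move=> T0 Z0.
have cross i j : \sum_(g : {ffun I -> T}) Z (g i) * Z (g j) =
    (i == j)%:R * (#|T|%:R ^+ #|I| * (#|T|%:R^-1 * \sum_t Z t ^+ 2)).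
  (* [F k] is the factor carried by coordinate [k], so the sum over [g] becomes a product of sums
     over [T]. *)
  pose F k t := (if k == i then Z t else 1) * (if k == j then Z t else 1).
  transitivity (\sum_(g : {ffun I -> T}) \prod_k F k (g k)).
    apply: eq_bigr => g _; rewrite big_split /= -!big_mkcond /=.
    by rewrite !big_pred1_eq.
  rewrite -(bigA_distr_bigA F) (bigD1 i) //= /F eqxx.
  case: eqP => [<-|_]; last first.
    by under eq_bigr do rewrite mulr1; rewrite Z0 !mul0r.
  have -> : #|T|%:R ^+ #|I| = #|T|%:R * \prod_(k | k != i) #|T|%:R :> R.
    by rewrite -prodr_const (bigD1 i).
  have -> : \prod_(k | k != i) \sum_t (if k == i then Z t else 1) * (if k == i then Z t else 1) =
      \prod_(k | k != i) #|T|%:R.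
    apply: eq_bigr => k /negPf ki; rewrite ki.
    by under eq_bigr do rewrite mulr1; rewrite sumr_const.
  rewrite mul1r mulrACA divff ?pnatr_eq0 -?lt0n // mul1r mulrC.
  by congr (_ * _); apply: eq_bigr => t _; rewrite expr2.
transitivity (\sum_(g : {ffun I -> T}) \sum_i \sum_j Z (g i) * Z (g j)).
  by apply: eq_bigr => g _; rewrite expr2 big_distrlr.
rewrite exchange_big -mulrA mulr_natl -sumr_const; apply: eq_bigr => i _ /=.
rewrite exchange_big (bigD1 i) //= cross eqxx mul1r [X in _ + X]big1 ?addr0 // => j /negPf ji.
by rewrite cross eq_sym ji mul0r.
Qed.

(** A middle entry of the sorted list that is off by [gamma] on one side takes along every entry
    beyond it on that side, at least half of the list. *)
Lemma count_median_tail (s : seq R) (mu gamma : R) : (0 < size s)%N -> 0 < gamma ->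
  gamma <= `|median s - mu| ->
  (size s <= (count (fun x => (gamma <= `|x - mu|)%R) s).*2)%N.
Proof.
move=> s0 g0 hmed.
set P := fun x => _.
set t := sort <=%R s.
have st : sorted <=%R t by apply: sort_sorted; exact: le_total.
have szt : size t = size s by rewrite size_sort.
have -> : count P s = count P t by apply/permP; rewrite perm_sym perm_sort.
rewrite -szt.
set N := size t.
have N0 : (0 < N)%N by rewrite /N szt.
have mono i j : (i <= j)%N -> (j < N)%N -> t`_i <= t`_j.
  move=> ij jN; apply: (sorted_leq_nth le_trans le_refl 0 st); rewrite ?inE //.
  exact: leq_ltn_trans ij jN.
have above i : (i < N)%N -> mu + gamma <= t`_i -> (N - i <= count P t)%N.
  move=> iN hi; rewrite -[in count _ _](cat_take_drop i t) count_cat.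
  apply: (@leq_trans (count P (drop i t))); last exact: leq_addl.
  rewrite -size_drop; apply: eq_leq; apply/esym/eqP; rewrite -all_count.
  apply/(all_nthP 0) => k; rewrite size_drop nth_drop => kN; rewrite /P.
  have ikN : (i + k < N)%N by rewrite -ltn_subRL.
  have := mono i (i + k)%N (leq_addr _ _) ikN.
  by move=> h; rewrite ler_normr; apply/orP; left; lra.
have below i : (i < N)%N -> t`_i <= mu - gamma -> (i.+1 <= count P t)%N.
  move=> iN hi; rewrite -[in count _ _](cat_take_drop i.+1 t) count_cat.
  apply: (@leq_trans (count P (take i.+1 t))); last exact: leq_addr.
  have szi : size (take i.+1 t) = i.+1 by rewrite size_takel.
  rewrite -{1}szi; apply: eq_leq; apply/esym/eqP; rewrite -all_count.
  apply/(all_nthP 0) => k; rewrite szi => ki; rewrite nth_take // /P.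
  have := mono k i ki iN.
  by move=> h; rewrite ler_normr; apply/orP; right; lra.
have N2 := odd_double_half N.
have N2N : (N./2 < N)%N by rewrite -divn2 ltn_Pdiv.
have half_above : mu + gamma <= t`_(N./2) -> (N <= (count P t).*2)%N.
  by move=> /(above _ N2N); lia.
move: hmed; rewrite /median -/t -/N.
case: ifPn => oddN.
  rewrite ler_normr => /orP[h|h].
    by apply: half_above; lra.
  have : t`_(N./2) <= mu - gamma by lra.
  by move=> /(below _ N2N); lia.
(* For even [N] the median is an average: if it is too high then so is the upper middle entry, and
   if too low then so is the lower one, at index [N./2 - 1]. Either way at least [N./2] entries are
   bad. *)
have pN : (N./2.-1 < N)%N by lia.
have pp := mono N./2.-1 N./2 (leq_pred _) N2N.
rewrite ler_normr => /orP[h|h].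
  by apply: half_above; lra.
have : t`_(N./2.-1) <= mu - gamma by lra.
by move=> /(below _ pN); lia.
Qed.

(* Markov's inequality for a product of independent weights [e^(+-1)]. *)
Lemma card_majority_le (T : finType) (B : pred T) (K : nat) :
  #|[set f : {ffun 'I_K -> T} | (K <= (#|[set k | B (f k)]|).*2)%N]|%:R <=
  (\sum_t if B t then expR 1 else expR (- 1)) ^+ K :> R.
Proof.
have -> : (\sum_t if B t then expR 1 else expR (- 1)) ^+ K =
    \prod_(k < K) \sum_t (if B t then expR 1 else expR (- 1)) :> R.
  by rewrite prodr_const card_ord.
rewrite (bigA_distr_bigA (fun _ t => if B t then expR 1 else expR (- 1) : R)) /=.
rewrite -sum1_card natr_sum [leLHS]big_mkcond /=; apply: ler_sum => f _.
rewrite inE; case: ifPn => maj; last by apply: prodr_ge0 => k _; case: ifP; rewrite expR_ge0.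
(* The product of the weights is [e] to the power of twice the number of [k] in [B] minus [K], hence
   at least 1 under [maj]. *)
rewrite (eq_bigr (fun k => expR (if B (f k) then 1 else - 1))); last first.
  by move=> k _; case: ifP.
rewrite -expR_sum -[leLHS]expR0 ler_expR.
have -> : \sum_(k < K) (if B (f k) then 1 else - 1) =
    \sum_(k < K) (2 * (B (f k))%:R - 1) :> R.
  by apply: eq_bigr => k _; case: (B (f k)) => /=; lra.
rewrite sumrB -mulr_sumr sumr_const card_ord subr_ge0.
have -> : \sum_(k < K) (B (f k))%:R = #|[set k | B (f k)]|%:R :> R.
  rewrite -sum1_card natr_sum [RHS]big_mkcond; apply: eq_bigr => k _.
  by rewrite inE; case: (B (f k)).
by rewrite -natrM ler_nat mul2n.
Qed.

Lemma card_majority_expR_le (T : finType) (B : pred T) (K : nat) :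
  #|[set t | B t]|%:R <= #|T|%:R / (2 * expR 1 ^+ 2) :> R ->
  #|[set f : {ffun 'I_K -> T} | (K <= (#|[set k | B (f k)]|).*2)%N]|%:R <=
  #|T|%:R ^+ K * expR (- (K%:R / 2)) :> R.
Proof.
move=> hB; apply: le_trans (card_majority_le _ _) _.
have -> : expR (- (K%:R / 2)) = expR (- (2^-1)) ^+ K :> R.
  by rewrite -expRM_natl; congr expR; ring.
rewrite -exprMn; have e0 := expR_gt0 (1 : R).
have W0 t : 0 <= (if B t then expR 1 else expR (- 1) : R) by case: ifP; rewrite expR_ge0.
rewrite lerXn2r ?nnegrE ?sumr_ge0 ?mulr_ge0 ?expR_ge0 //.
(* Every point gets weight [1/e] and each point of [B] an extra [e]: this overshoots only by [1/e]
   per point of [B] and lets the density of [B] enter linearly. *)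
apply: (@le_trans _ _ (#|T|%:R * expR (- 1) + expR 1 * #|[set t | B t]|%:R)).
  rewrite -!sum1_card !natr_sum mulr_suml mulr_sumr [X in _ + X]big_mkcond -big_split.
  apply: ler_sum => t _ /=; rewrite inE mul1r mulr1.
  by case: ifP => _; rewrite ?addr0 // lerDr expR_ge0.
apply: (@le_trans _ _ (#|T|%:R * (expR (- 1) * (1 + 2^-1)))).
  have : expR 1 * #|[set t | B t]|%:R <= expR 1 * (#|T|%:R / (2 * expR 1 ^+ 2)) :> R.
    by rewrite ler_pM2l.
  have -> : expR 1 * (#|T|%:R / (2 * expR 1 ^+ 2)) = #|T|%:R * (expR (- 1) * 2^-1) :> R.
    by rewrite expRN; field; rewrite gt_eqF.
  by lra.
rewrite ler_wpM2l //.
(* With [e^-1] factored out, only [1 + 1/2 <= e^(1/2)] is left. *)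
have -> : expR (- 2^-1) = expR (- 1) * expR 2^-1 :> R by rewrite -expRD; congr expR; lra.
by rewrite ler_pM2l ?expR_gt0 // expR_ge1Dx.
Qed.

End Tails.

(** * Failure probability of a median of block means *)

Section MedianOfMeans.
Set Implicit Arguments.
Unset Strict Implicit.
Variable R : realType.

(** A sample of [J * K] draws is seen as [K] draws from the space of blocks [{ffun 'I_J -> T}]:
    Chebyshev bounds the share of bad blocks, and the majority bound is applied over that space. *)
Lemma median_of_means_tail (T : finType) (Y : T -> R) (mu v gamma : R) (J K : nat) :
  (0 < #|T|)%N -> (0 < J)%N -> (0 < K)%N -> 0 < gamma ->
  #|T|%:R^-1 * \sum_t Y t = mu -> #|T|%:R^-1 * \sum_t (Y t - mu) ^+ 2 <= v ->
  2 * expR 1 ^+ 2 * v / gamma ^+ 2 <= J%:R ->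
  #|[set f : {ffun 'I_J * 'I_K -> T} | gamma <=
      `|median [seq J%:R^-1 * \sum_j Y (f (j, k)) | k <- enum 'I_K] - mu|]|%:R <=
  #|T|%:R ^+ (J * K) * expR (- (K%:R / 2)) :> R.
Proof.
move=> T0 J0 K0 g0 meanY varY hJ.
have Tn0 : #|T|%:R != 0 :> R by rewrite pnatr_eq0 -lt0n.
have Jp : 0 < J%:R :> R by rewrite ltr0n.
pose Z t := Y t - mu.
have Z0 : \sum_t Z t = 0.
  by rewrite sumrB sumr_const -mulr_natl -meanY mulVKf // subrr.
pose B (g : {ffun 'I_J -> T}) := gamma <= `|J%:R^-1 * \sum_j Y (g j) - mu|.
have BE (g : {ffun 'I_J -> T}) : J%:R^-1 * \sum_j Y (g j) - mu = J%:R^-1 * \sum_j Z (g j).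
  have cst : \sum_(j < J) mu = J%:R * mu by rewrite sumr_const card_ord mulr_natl.
  have -> : \sum_j Z (g j) = \sum_j Y (g j) - J%:R * mu
    by rewrite -cst -sumrB.
  by rewrite mulrBr mulKf // gt_eqF.
pose n := #|{: {ffun 'I_J -> T}}|.
have nE : n%:R = #|T|%:R ^+ J :> R by rewrite /n card_ffun card_ord natrX.
(* Chebyshev as a count: every bad block has [(\sum_j Z (g j)) ^+ 2 >= (J gamma)^2], and these
   squares sum to [J n] times the variance of [Y]. *)
have cheb : #|[set g | B g]|%:R * (J%:R * gamma) ^+ 2 <= J%:R * n%:R * v.
  apply: (@le_trans _ _ (\sum_(g : {ffun 'I_J -> T}) (\sum_j Z (g j)) ^+ 2)).
    rewrite mulr_natl -sumr_const big_mkcond; apply: ler_sum => g _; rewrite inE.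
    case: ifPn => [|_]; last exact: sqr_ge0.
    rewrite /B BE normrM gtr0_norm ?invr_gt0 // ler_pdivlMl // => h.
    by rewrite -[leRHS]real_normK ?num_real // ler_sqr ?nnegrE // mulr_ge0 // ltW.
  rewrite (sum_ffun_sqr _ T0 Z0) card_ord nE; apply: ler_wpM2l varY.
  by rewrite mulr_ge0 ?exprn_ge0.
have hB : #|[set g | B g]|%:R <= n%:R / (2 * expR 1 ^+ 2) :> R.
  have e0 : 0 < 2 * expR 1 ^+ 2 :> R by rewrite mulr_gt0 // exprn_gt0 // expR_gt0.
  rewrite ler_pdivlMr //.
  have gg : 0 < gamma ^+ 2 by rewrite exprn_gt0.
  rewrite ler_pdivrMr // in hJ.
  (* Scaling by [J^2 gamma^2] produces the left side of [cheb]; the lower bound on [J] then replaces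
     [2 e^2 v] by [J gamma^2]. *)
  rewrite -(ler_pM2r gg) -(ler_pM2l Jp) -(ler_pM2l Jp).
  apply: (@le_trans _ _ ((J%:R * n%:R * v) * (2 * expR 1 ^+ 2))).
    apply: le_trans (ler_wpM2r (ltW e0) cheb).
    by rewrite le_eqVlt; apply/orP; left; apply/eqP; ring.
  apply: (@le_trans _ _ (J%:R * n%:R * (J%:R * gamma ^+ 2))).
    apply: (@le_trans _ _ (J%:R * n%:R * (2 * expR 1 ^+ 2 * v))).
      by rewrite le_eqVlt; apply/orP; left; apply/eqP; ring.
    by rewrite ler_wpM2l // mulr_ge0.
  by rewrite le_eqVlt; apply/orP; left; apply/eqP; ring.
have := @card_majority_expR_le R _ B K hB.
rewrite -/n nE -exprM; apply: le_trans; rewrite ler_nat.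
pose curry (f : {ffun 'I_J * 'I_K -> T}) : {ffun 'I_K -> {ffun 'I_J -> T}} :=
  [ffun k => [ffun j => f (j, k)]].
have curry_inj : injective curry.
  move=> f f' ff'; apply/ffunP => -[j k].
  by have /ffunP/(_ k) := ff'; rewrite !ffunE => /ffunP/(_ j); rewrite !ffunE.
rewrite -(card_imset _ curry_inj); apply: subset_leq_card; apply/fintype.subsetP => _ /imsetP[f fP ->].
move: fP; rewrite !inE => /(count_median_tail _ g0).
rewrite size_map size_enum_ord => /(_ K0).
rewrite count_map -sum1_count big_enum_cond /= sum1_card.
congr (_ <= _.*2)%N; apply: eq_card => k; rewrite !inE /B ffunE.
by under [in RHS]eq_bigr do rewrite ffunE.
Qed.

End MedianOfMeans.

(* z_{jk} = sqrt d * Pi u_{l(j,k)} with l : 'I_J * 'I_K -> 'I_L drawn uniformly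
   (i.e. J*K independent uniform indices); the probability is the proportion
   of such index assignments for which the event holds. *)
Theorem theorem2p4 (R : realType) (m n d L : nat) (A : 'M[R]_(m, n))
  (hnd : (n <= d)%N) (u : 'I_L -> 'cV[R]_d)
  (hu : projective_2design u)
  (x : 'cV[R]_n) (hx : eucl_norm (fun i => x i 0) = 1)
  (gamma eta : R) (hgamma : 0 < gamma) (heta0 : 0 < eta) (heta1 : eta < 1)
  (J K : nat) (hJ0 : (0 < J)%N) (hK0 : (0 < K)%N)
  (hJ : 4 * expR 1 ^+ 2 * norm_2inf A ^+ 2 / gamma ^+ 2 <= J%:R)
  (hK : 2 * ln (m%:R / eta) <= K%:R) :
  let z (l : 'I_L) : 'cV[R]_n :=
    \col_(i < n) (Num.sqrt d%:R * u l (widen_ord hnd i) 0) in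
  let y (l : 'I_L) : 'cV[R]_m := A *m z l *m (z l)^T *m x in
  let ybar (f : {ffun 'I_J * 'I_K -> 'I_L}) (k : 'I_K) : 'cV[R]_m :=
    (J%:R)^-1 *: \sum_(j < J) y (f (j, k)) in
  let muhat (f : {ffun 'I_J * 'I_K -> 'I_L}) : 'cV[R]_m :=
    \col_(i < m) median [seq ybar f k i 0 | k <- enum 'I_K] in
  1 - eta <=
    #|[set f : {ffun 'I_J * 'I_K -> 'I_L} | norm_inf (muhat f - A *m x) < gamma]|%:R
    / (L%:R ^+ (J * K)).
Proof.
(* A unit vector has at least one coordinate, so [n] and hence [d] are positive, as the moment
   lemmas require. *)
have n0 : (0 < n)%N.
  case: n hnd x hx {A hJ} => // h x' /eqP.
  by rewrite /eucl_norm big_ord0 sqrtr0 eq_sym oner_eq0.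
case: d => [|d'] in hnd u hu *.
  by have := leq_trans n0 hnd.
cbv zeta.
pose z (l : 'I_L) : 'cV[R]_n := \col_(i < n) (Num.sqrt d'.+1%:R * u l (widen_ord hnd i) 0).
pose y (l : 'I_L) : 'cV[R]_m := A *m z l *m (z l)^T *m x.
pose ybar (f : {ffun 'I_J * 'I_K -> 'I_L}) (k : 'I_K) : 'cV[R]_m :=
  (J%:R)^-1 *: \sum_(j < J) y (f (j, k)).
pose muhat (f : {ffun 'I_J * 'I_K -> 'I_L}) : 'cV[R]_m :=
  \col_(i < m) median [seq ybar f k i 0 | k <- enum 'I_K].
pose good := [set f | norm_inf (muhat f - A *m x) < gamma].
suff : 1 - eta <= #|good|%:R / (L%:R ^+ (J * K)) by [].
have goodE f : (f \in good) = (norm_inf (muhat f - A *m x) < gamma) by rewrite inE.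
have L0 := design_size_gt0 hu.
(* Padding by zeros, the adjoint of the projection onto the first [n] coordinates: [widen_ord] is
   injective, so the sum has at most one term. *)
pose ext (a : 'I_n -> R) (k : 'I_d'.+1) := \sum_(j | widen_ord hnd j == k) a j.
have inner_ext a w : inner (ext a) w = \sum_j a j * w (widen_ord hnd j).
  rewrite /inner /ext; under eq_bigr do rewrite mulr_suml.
  rewrite (exchange_big_dep xpredT) //=; apply: eq_bigr => j _.
  by rewrite (big_pred1 (widen_ord hnd j)) // => k; rewrite eq_sym.
have ext_widen a j : ext a (widen_ord hnd j) = a j.
  by rewrite /ext (big_pred1 j) //.
pose a i := ext (fun j => A i j).
pose x' := ext (fun j => x j 0).
have inner_a_x i : inner (a i) x' = (A *m x) i 0.
  by rewrite inner_ext mxE; apply: eq_bigr => j _; rewrite /x' ext_widen.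
have x'1 : inner x' x' = 1.
  rewrite inner_ext -[RHS](expr1n _ 2) -hx sqr_sqrtr; last first.
    by apply: sumr_ge0 => j _; exact: sqr_ge0.
  by apply: eq_bigr => j _; rewrite ?/x' ?/a ext_widen expr2.
(* The two factors [sqrt d] in [z z^T] combine to the [d] of the sample [d (a . u) (x . u)], whose
   mean and variance are known. *)
have yE l i : y l i 0 = d'.+1%:R * inner (a i) (fun k => u l k 0) * inner x' (fun k => u l k 0).
  have zE b : \sum_j b j * z l j 0 =
      Num.sqrt d'.+1%:R * inner (ext b) (fun k => u l k 0).
    by rewrite inner_ext mulr_sumr; apply: eq_bigr => j _; rewrite mxE mulrCA.
  have Az : (A *m z l) i 0 = Num.sqrt d'.+1%:R * inner (a i) (fun k => u l k 0).
    by rewrite mxE zE.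
  have zx : ((z l)^T *m x) 0 0 = Num.sqrt d'.+1%:R * inner x' (fun k => u l k 0).
    by rewrite mxE -zE; apply: eq_bigr => j _; rewrite mxE mulrC.
  rewrite /y -mulmxA mxE big_ord1 Az zx mulrACA -expr2 sqr_sqrtr ?ler0n //.
  by rewrite mulrA.
have row_le i : inner (a i) (a i) <= norm_2inf A ^+ 2.
  have -> : inner (a i) (a i) = eucl_norm (fun j => A i j) ^+ 2.
    rewrite inner_ext /eucl_norm sqr_sqrtr; last by apply: sumr_ge0 => j _; exact: sqr_ge0.
    by apply: eq_bigr => j _; rewrite ?/x' ?/a ext_widen expr2.
  rewrite ler_sqr ?nnegrE ?sqrtr_ge0 //; last first.
    by apply: le_trans (le_bigmax _ _ i); exact: sqrtr_ge0.
  exact: (le_bigmax _ (fun i => eucl_norm (fun j => A i j))).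
pose bad i := [set f : {ffun 'I_J * 'I_K -> 'I_L} | gamma <= `|muhat f i 0 - (A *m x) i 0|].
have LT : #|'I_L| = L by rewrite card_ord.
have bad_le i : #|bad i|%:R <= L%:R ^+ (J * K) * expR (- (K%:R / 2)) :> R.
  have := @median_of_means_tail R _ (fun l => y l i 0) ((A *m x) i 0) (2 * norm_2inf A ^+ 2) gamma J K.
  rewrite LT => /(_ L0 hJ0 hK0 hgamma).
  have mE : L%:R^-1 * \sum_l y l i 0 = (A *m x) i 0.
    by under eq_bigr do rewrite yE; rewrite (design_sample_mean hu) inner_a_x.
  have vE : L%:R^-1 * \sum_l (y l i 0 - (A *m x) i 0) ^+ 2 <= 2 * norm_2inf A ^+ 2.
    under eq_bigr do rewrite yE -inner_a_x.
    apply: le_trans (design_sample_variance hu _ x'1) _.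
    by rewrite ler_pM2l.
  move=> /(_ mE vE).
  have hJ' : 2 * expR 1 ^+ 2 * (2 * norm_2inf A ^+ 2) / gamma ^+ 2 <= J%:R.
    apply: le_trans hJ; rewrite le_eqVlt; apply/orP; left; apply/eqP; congr (_ / _); ring.
  move=> /(_ hJ'); apply: le_trans; rewrite ler_nat; apply: subset_leq_card; apply/fintype.subsetP => f.
  rewrite !inE mxE; congr (_ <= `|median _ - _|); apply: eq_map => k.
  by rewrite /ybar mxE summxE.
have cover : (#|~: good| <= \sum_i #|bad i|)%N.
  have sub : ~: good \subset \bigcup_i bad i.
    apply/fintype.subsetP => f; rewrite finset.in_setC goodE => /bigmax_ltP h.
    (* The maximum starts from 0, so staying below [gamma] also uses [0 < gamma]. *)
    apply/bigcupP; apply: contrapT => none; apply: h; split => // i _.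
    rewrite ltNge; apply/negP => hi; apply: none; exists i => //.
    by rewrite inE; move: hi; rewrite !mxE.
  apply: leq_trans (subset_leq_card sub) _.
  elim/big_rec2: _ => [|i c B _ le]; first by rewrite cards0.
  by apply: leq_trans (leq_card_setU _ _) _; rewrite leq_add2l.
have LJK : 0 < L%:R ^+ (J * K) :> R by rewrite exprn_gt0 // ltr0n.
rewrite ler_pdivlMr //.
have tot : #|good|%:R + #|~: good|%:R = L%:R ^+ (J * K) :> R.
  by rewrite -natrD cardsC card_ffun card_prod !card_ord natrX.
have fail : #|~: good|%:R <= eta * L%:R ^+ (J * K).
  apply: (@le_trans _ _ (\sum_i #|bad i|%:R)); first by rewrite -natr_sum ler_nat.
  apply: (@le_trans _ _ (\sum_(i < m) L%:R ^+ (J * K) * expR (- (K%:R / 2)))).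
    by apply: ler_sum => i _; exact: bad_le.
  rewrite sumr_const card_ord -[leLHS]mulr_natl mulrCA mulrC ler_pM2r //.
  (* For [m = 0] the logarithmic condition says nothing, but no coordinate can fail. *)
  case: (posnP m) => [->|m0]; first by rewrite mul0r ltW.
  have mp : 0 < m%:R / eta :> R by rewrite divr_gt0 // ltr0n.
  (* [m e^(-K/2) <= eta] is rewritten as [m / eta <= e^(K/2)], which is [hK] after taking
     logarithms. *)
  rewrite expRN -ler_pdivlMr ?invr_gt0 ?expR_gt0 // invrK.
  rewrite mulrC -ler_pdivrMr // -[leLHS]lnK ?posrE // ler_expR; lra.
lra.
Qed.
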